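(* Let $p\ge3$ and fix $\beta_0\in(\beta^*(p),\log2)$. There exists $\underline{\beta}>0$ such that, for $\delta\in(0,1)$, $$N_{\hat{\beta}_{\mathrm{MPL}}}^*(\beta_0,\beta,\delta,p)=-\frac{\log(\delta)}{H_{\beta_0,p}(m_*(\beta_0,p))}>0\quad\text{for all }\beta>\underline{\beta}.$$
   Context: **Model.** For an integer $p\ge2$ and $n\ge 1$, the $p$-tensor Curie-Weiss model with parameter $\beta$ is the probability mass function on $\{-1,1\}^n$ $$\mathbb{P}_{\beta,p}(x)=\frac{\exp\{\beta n^{1-p}\sum_{1\le i_1,\dots,i_p\le n}x_{i_1}\cdots x_{i_p}\}}{2^nZ_n(\beta,p)},$$ with $Z_n(\beta,p)$ the normalizing constant. $X=(X_1,\dots,X_n)$ denotes a sample from it and $\overline{X}_n=\frac1n\sum_{i=1}^nX_i$. **Functions and threshold.** For $x\in[-1,1]$ (with $0\log0=0$), $H_{\beta,p}(x)=\beta x^p-\tfrac12\{(1+x)\log(1+x)+(1-x)\log(1-x)\}$, and $\beta^*(p)=\sup\{\beta\ge0:\sup_{x\in[-1,1]}H_{\beta,p}(x)=0\}$. For $\beta>\beta^*(p)$, $m_*(\beta,p)\in(0,1)$ denotes the unique positive global maximizer of $H_{\beta,p}$. **Estimator.** The maximum pseudolikelihood estimator is given explicitly by $\hat{\beta}_{\mathrm{MPL}}=p^{-1}\overline{X}_n^{1-p}\tanh^{-1}(\overline{X}_n)$ if $\overline{X}_n\ne0$ and $0$ if $\overline{X}_n=0$ (extended-real valued when $\overline X_n=\pm1$).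 **Bahadur slope.** Consider testing $H_0:\beta=\beta_0$ versus $H_1:\beta>\beta_0$ with $\beta_0>\beta^*(p)$ using $T_n=\sqrt n(\hat{\beta}_{\mathrm{MPL}}-\beta_0)$, large values being significant. Let $F_{T_n,\beta_0}$ be the cumulative distribution function of $T_n$ under $\mathbb{P}_{\beta_0,p}$ and $L_n=1-F_{T_n,\beta_0}(T_n)$. The (weak) Bahadur slope at the alternative $\beta>\beta_0$ is the constant $c_{\hat{\beta}_{\mathrm{MPL}}}(\beta_0,\beta,p)$ such that $\frac1n\log L_n\to-\frac12c_{\hat{\beta}_{\mathrm{MPL}}}(\beta_0,\beta,p)$ in probability as $n\to\infty$ when $X\sim\mathbb{P}_{\beta,p}$. The asymptotic optimal sample size is $N^*_{\hat{\beta}_{\mathrm{MPL}}}(\beta_0,\beta,\delta,p)=-2\log(\delta)/c_{\hat{\beta}_{\mathrm{MPL}}}(\beta_0,\beta,p)$. *)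

(* Defs.v *)
From HB Require Import structures.
From mathcomp Require Import all_boot all_order all_algebra.
From mathcomp Require Import all_classical all_reals all_analysis.
From mathcomp Require Import ring lra.

Set Implicit Arguments.
Unset Strict Implicit.
Unset Printing Implicit Defensive.

Import Order.TTheory GRing.Theory Num.Theory.
Import numFieldNormedType.Exports.
Local Open Scope classical_set_scope.
Local Open Scope ring_scope.

(* A configuration in {-1,1}^n, encoded by signs: true is +1, false is -1. *)
Definition config (n : nat) := {ffun 'I_n -> bool}.

Section CurieWeiss.
Context {R : realType}.
Implicit Types (beta c delta x : R) (p n : nat).

Definition spin n (s : config n) (i : 'I_n) : R := if s i then 1 else - 1.

(* The inner sum ranges over all p-tuples (i_1, ..., i_p) of indices. *)
Definition weight beta p n (s : config n) : R :=
  expR (beta * n%:R ^ (1 - p%:Z)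
        * \sum_(i : {ffun 'I_p -> 'I_n}) \prod_(k < p) spin s (i k)).

Definition Z_ beta p n : R :=
  (2 ^+ n)^-1 * \sum_(s : config n) weight beta p s.

Definition pmf beta p n (s : config n) : R :=
  weight beta p s / (2 ^+ n * Z_ beta p n).

Definition Pr beta p n (A : pred (config n)) : R :=
  \sum_(s : config n | A s) pmf beta p s.

Definition mean n (s : config n) : R := n%:R^-1 * \sum_(i < n) spin s i.

(* At x = -1 and x = 1 the convention 0 log 0 = 0 holds since ln 0 = 0. *)
Definition H beta p x : R :=
  beta * x ^+ p - 2^-1 * ((1 + x) * ln (1 + x) + (1 - x) * ln (1 - x)).

Definition beta_star p : R :=
  sup [set b : R | 0 <= b /\ sup [set H b p x | x in `[-1, 1]] = 0].

Definition positive_maximizer beta p (m : R) : Prop :=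
  0 < m < 1 /\ forall x, x \in `[-1, 1] -> H beta p x <= H beta p m.

(* The value is 0 if there is no positive global maximizer. *)
Definition m_star beta p : R := xget 0 [set m | positive_maximizer beta p m].

Definition tanh (y : R) : R := (expR y - expR (- y)) / (expR y + expR (- y)).

(* Meaningful for -1 < x < 1 only; see atanhK and tanhK. *)
Definition atanh x : R := 2^-1 * ln ((1 + x) / (1 - x)).

Definition eatanh x : \bar R :=
  if x == 1 then +oo%E else if x == - 1 then -oo%E else (atanh x)%:E.

(* At mean = -1 the product in \bar R is +oo for even p and -oo for odd p. *)
Definition beta_MPL p n (s : config n) : \bar R :=
  if mean s == 0 then 0%E
  else ((p%:R^-1 * mean s ^ (1 - p%:Z))%:E * eatanh (mean s))%E.

Definition T_stat (beta0 : R) p n (s : config n) : \bar R :=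
  ((Num.sqrt n%:R)%:E * (beta_MPL p s - beta0%:E))%E.

Definition cdf_T (beta0 : R) p n (t : \bar R) : R :=
  Pr beta0 p [pred s : config n | (T_stat beta0 p s <= t)%E].

Definition L_stat (beta0 : R) p n (s : config n) : R :=
  1 - cdf_T beta0 p n (T_stat beta0 p s).

(* (1/n) log L_n --> - c/2 in probability under P_{beta,p}. The logarithm is
   extended-real valued: L_n = 0 at the largest value of T_n, and then
   log L_n = -oo, so that such configurations count as deviations. *)
Definition is_bahadur_slope (beta0 : R) beta p c : Prop :=
  forall eps : R, 0 < eps ->
    (fun n => Pr beta p [pred s : config n |
       (eps%:E < `| (n%:R^-1)%:E * lne (L_stat beta0 p s)%:E
                    - (- (2^-1 * c))%:E |)%E]) @ \oo --> (0 : R).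

(* The value is 0 if (1/n) log L_n has no finite limit in probability. *)
Definition bahadur_slope (beta0 : R) beta p : R :=
  xget 0 [set c | is_bahadur_slope beta0 beta p c].

(* As 0^-1 = 0, this is 0 when the slope is 0 or does not exist; a positive
   value therefore certifies that the slope exists and is nonzero. *)
Definition N_star (beta0 : R) beta delta p : R :=
  - 2 * ln delta / bahadur_slope beta0 beta p.

Lemma tanhK : cancel tanh atanh.
Proof.
move=> y; rewrite /atanh /tanh expRN.
have e0 := expR_gt0 y; set E := expR y in e0 *.
have -> : (1 + (E - E^-1) / (E + E^-1)) / (1 - (E - E^-1) / (E + E^-1)) = E ^+ 2.
  by field; apply/and3P; split; rewrite lt0r_neq0//; nra.
by rewrite lnXn// /E expRK -[y *+ 2]mulr_natl mulKf// pnatr_eq0.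
Qed.

Lemma atanhK x : -1 < x < 1 -> tanh (atanh x) = x.
Proof.
move=> /andP[x1 x2]; rewrite /tanh expRN.
have p1 : 0 < 1 + x by lra.
have p2 : 0 < 1 - x by lra.
have e0 := expR_gt0 (atanh x).
have : expR (atanh x) ^+ 2 = (1 + x) / (1 - x).
  rewrite -expRM_natl /atanh mulrA divff ?pnatr_eq0// mul1r lnK//.
  by rewrite posrE divr_gt0.
set E := expR _ in e0 * => EE.
have -> : (E - E^-1) / (E + E^-1) = (E ^+ 2 - 1) / (E ^+ 2 + 1).
  by field; apply/andP; split; rewrite lt0r_neq0//; nra.
by rewrite EE; field; apply/andP; split; rewrite lt0r_neq0//; lra.
Qed.

End CurieWeiss.

(* Main.v *)
Require Import Defs.
From HB Require Import structures.
From mathcomp Require Import all_boot all_order all_algebra.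
From mathcomp Require Import all_classical all_reals all_analysis.
From mathcomp Require Import ring lra zify.

Import Order.TTheory GRing.Theory Num.Theory.
Import numFieldNormedType.Exports.
Local Open Scope ring_scope.

(* With g(x) = x^(1-p) atanh(x) / p, the estimator is g evaluated at the mean,
   and g(x) = beta at every global maximizer x of H_beta, by the first-order
   condition. Under P_beta the mean concentrates at these maximizers, so for
   beta large the observed value of g lies with high probability between a
   constant M and beta + 1, where M bounds g on the set {H_beta0 > 0}. Then
   L_n is at most P_beta0(H_beta0(mean) <= 0), which is about
   exp(- n max H_beta0). Conversely g(x) -> +oo as x -> 0+ because p >= 3, so L_n
   is at least the probability of the smallest positive mean, which has the same
   exponential order because H_beta0(0) = 0. The condition beta0 < ln 2 says
   H_beta0(1) < 0, so that g is bounded on {H_beta0 > 0}. Hence the slope is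
   2 max H_beta0. *)

(** * Binomial counts *)

(** The ratio of consecutive terms, [(n - j) k / ((j + 1) (n - k))], cross-multiplied to stay in
    [nat]. *)
Lemma binomial_weight_succ (n k j : nat) : (k <= n)%N -> (j < n)%N ->
  (j.+1 * (n - k) * ('C(n, j.+1) * (k ^ j.+1 * (n - k) ^ (n - j.+1))) =
   (n - j) * k * ('C(n, j) * (k ^ j * (n - k) ^ (n - j))))%N.
Proof.
move=> kn jn; have e1 := mul_bin_left n j.
have e2 : ((n - k) ^ (n - j) = (n - k) * (n - k) ^ (n - j.+1))%N.
  by rewrite -expnS; congr (_ ^ _)%N; lia.
rewrite e2 expnS.
transitivity ((n - k) * (k * k ^ j) * (n - k) ^ (n - j.+1) * (j.+1 * 'C(n, j.+1)))%N.
  by ring.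
by rewrite e1; ring.
Qed.

(* The binomial distribution with parameters n and k/n has its mode at k. *)
Lemma binomial_mode (n k j : nat) : (k <= n)%N -> (j <= n)%N ->
  ('C(n, j) * (k ^ j * (n - k) ^ (n - j))
   <= 'C(n, k) * (k ^ k * (n - k) ^ (n - k)))%N.
Proof.
move=> kn jn; set a := fun j => ('C(n, j) * (k ^ j * (n - k) ^ (n - j)))%N.
rewrite -/(a j) -/(a k).
have [->//|neq_jk] := eqVneq j k.
have [nk|nk] := eqVneq (n - k)%N 0%N.
  by rewrite /a nk exp0n ?muln0//; lia.
have step (i : nat) : (i < n)%N ->
    (i.+1 * (n - k) * a i.+1 = (n - i) * k * a i)%N by exact: binomial_weight_succ.
have cancel (c c' x y : nat) : (0 < c')%N -> (c <= c')%N ->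
    (c * x = c' * y)%N -> (y <= x)%N.
  by move=> c'0 cc' e; rewrite -(leq_pmul2l c'0) -e leq_mul2r cc' orbT.
(* The ratio of consecutive terms is at least 1 below [k] and at most 1 from [k] on, so the terms
   increase up to [k] and decrease afterwards. *)
have up (d : nat) : (d <= k)%N -> (a (k - d) <= a k)%N.
  elim: d => [|d IH] dk; first by rewrite subn0.
  apply: leq_trans (IH (ltnW dk)).
  have /step : (k - d.+1 < n)%N by lia.
  have -> : (k - d.+1).+1 = (k - d)%N by lia.
  apply: cancel.
    nia.
  nia.
have dn (d : nat) : (k + d <= n)%N -> (a (k + d) <= a k)%N.
  elim: d => [|d IH] dk; first by rewrite addn0.
  apply: leq_trans (IH ltac:(lia)).
  have /step : (k + d < n)%N by lia.
  rewrite addnS => /esym; apply: cancel.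
    nia.
  nia.
case: (leqP j k) => jk.
  by rewrite -(subKn jk) up// leq_subr.
by rewrite -(subnKC (ltnW jk)) dn// subnKC// ltnW.
Qed.

(** The left side is one term of the binomial expansion of [(k + (n - k)) ^ n]; the converse bound
    below uses that it is the largest of [n + 1] terms. *)
Lemma binomial_entropy_le (n k : nat) : (k <= n)%N ->
  ('C(n, k) * (k ^ k * (n - k) ^ (n - k)) <= n ^ n)%N.
Proof.
move=> kn; rewrite -{4}(subnK kn) expnDn.
rewrite (bigD1 (inord k)) //= inordK ?ltnS// [(_ ^ (n - k) * _)%N]mulnC.
exact: leq_addr.
Qed.

Lemma binomial_entropy_ge (n k : nat) : (k <= n)%N ->
  (n ^ n <= n.+1 * ('C(n, k) * (k ^ k * (n - k) ^ (n - k))))%N.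
Proof.
move=> kn; rewrite -{1}(subnK kn) expnDn.
rewrite -[n.+1 in leqRHS]card_ord -sum_nat_const.
apply: leq_sum => j _; rewrite [((n - k) ^ _ * _)%N]mulnC.
by apply: binomial_mode => //; rewrite -ltnS ltn_ord.
Qed.

(** * Probabilities of events on the mean *)

Section Configurations.
Context {R : realType}.
Implicit Types (beta h x : R) (p n k : nat).

(** The Cramer rate function of a fair sign: the entropy part of [H]. *)
Definition rate x : R := 2^-1 * ((1 + x) * ln (1 + x) + (1 - x) * ln (1 - x)).

Definition lattice n k : R := (2 * k%:R - n%:R) / n%:R.

Definition npos {n} (s : config n) : nat := #|[set i | s i]|.

Lemma npos_le n (s : config n) : (npos s <= n)%N.
Proof. by rewrite -[leqRHS]card_ord max_card. Qed.

Lemma sum_spin n (s : config n) :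
  \sum_(i < n) spin s i = 2 * (npos s)%:R - n%:R :> R.
Proof.
transitivity (\sum_(i < n) (2 * (s i)%:R - 1) : R).
  by apply: eq_bigr => i _; rewrite /spin; case: (s i) => /=; ring.
rewrite sumrB -mulr_sumr sumr_const card_ord -natr_sum /npos -sum1_card.
congr (2 * _%:R - _).
by rewrite [RHS]big_mkcond; apply: eq_bigr => i _; rewrite inE; case: (s i).
Qed.

Lemma mean_lattice n (s : config n) : mean s = lattice n (npos s).
Proof. by rewrite /mean sum_spin mulrC. Qed.

Lemma card_npos n k : #|[set s : config n | npos s == k]| = 'C(n, k).
Proof.
rewrite -[n in RHS]card_ord -card_draws.
rewrite -(@card_imset _ _ (fun s : config n => [set i | s i])%SET); last first.
  by move=> s t /setP st; apply/ffunP => i; have := st i; rewrite !inE.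
apply: eq_card => A; apply/imsetP/idP => [[s]|].
  by rewrite !inE => sk ->.
rewrite inE => Ak; exists [ffun i => i \in A].
  rewrite inE -(eqP Ak); apply/eqP.
  by apply: eq_card => i; rewrite !inE ffunE.
by apply/setP => i; rewrite inE ffunE.
Qed.

(** The sum over all [p]-tuples factors as the [p]-th power of the sum of the spins, so the weight
    depends on the mean only. *)
Lemma weightE beta p n (s : config n) : (0 < n)%N ->
  weight beta p s = expR (n%:R * (beta * mean s ^+ p)).
Proof.
move=> n0; have nR : n%:R != 0 :> R by rewrite pnatr_eq0 -lt0n.
rewrite /weight; congr expR.
have -> : \sum_(i : {ffun 'I_p -> 'I_n}) \prod_(k < p) spin s (i k)
    = (\sum_(i < n) spin s i) ^+ p :> R.
  by rewrite -(@bigA_distr_bigA _ _ _ _ _ _ _ (fun _ j => spin s j)) /= prodr_const card_ord.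
rewrite -[\sum_(i < n) _](mulVKf nR) -/(mean s) exprMn.
rewrite expfzDr// expr1z -exprnN -exprVn.
have e : n%:R^-1 ^+ p * n%:R ^+ p = 1 :> R by rewrite -exprMn mulVf// expr1n.
rewrite (_ : _ * _ * _ = (n%:R * (beta * mean s ^+ p)) *
    (n%:R^-1 ^+ p * n%:R ^+ p)); first by rewrite e mulr1.
by ring.
Qed.

Lemma expR_rate_lattice n k : (0 < n)%N -> (k <= n)%N ->
  expR (n%:R * rate (lattice n k)) =
    2 ^+ n * (k ^ k * (n - k) ^ (n - k))%:R / (n ^ n)%:R.
Proof.
move=> n0 kn; have nR : 0 < n%:R :> R by rewrite ltr0n.
have nR0 := lt0r_neq0 nR.
(* For [j = 0] the convention [0 ln 0 = 0] on the left matches [0 ^ 0 = 1] on the right. *)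
have key (j : nat) : expR (j%:R * ln (2 * j%:R / n%:R)) = (2 * j%:R / n%:R) ^+ j :> R.
  case: j => [|j]; first by rewrite mul0r expR0 expr0.
  by rewrite expRM_natl lnK// posrE divr_gt0// mulr_gt0.
have nk : (n - k)%:R = n%:R - k%:R :> R by rewrite natrB.
have e1 : 1 + lattice n k = 2 * k%:R / n%:R by rewrite /lattice; field.
have e2 : 1 - lattice n k = 2 * (n - k)%:R / n%:R by rewrite /lattice nk; field.
rewrite /rate e1 e2.
rewrite (_ : _ * _ = k%:R * ln (2 * k%:R / n%:R) +
    (n - k)%:R * ln (2 * (n - k)%:R / n%:R)); last by field.
have split_exp (y : R) : y ^+ n = y ^+ k * y ^+ (n - k) by rewrite -exprD subnKC.
rewrite expRD !key !exprMn !exprVn natrM !natrX !split_exp.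
by field; rewrite !expf_neq0.
Qed.

Lemma bin_le n k : (0 < n)%N -> (k <= n)%N ->
  'C(n, k)%:R * expR (n%:R * rate (lattice n k)) <= 2 ^+ n :> R.
Proof.
move=> n0 kn; rewrite expR_rate_lattice// mulrA ler_pdivrMr ?ltr0n ?expn_gt0 ?n0//.
rewrite mulrCA ler_pM2l ?exprn_gt0// -natrM ler_nat.
exact: binomial_entropy_le.
Qed.

Lemma bin_ge n k : (0 < n)%N -> (k <= n)%N ->
  2 ^+ n <= n.+1%:R * 'C(n, k)%:R * expR (n%:R * rate (lattice n k)) :> R.
Proof.
move=> n0 kn; rewrite expR_rate_lattice// mulrA ler_pdivlMr ?ltr0n ?expn_gt0 ?n0//.
rewrite mulrCA ler_pM2l ?exprn_gt0// -!natrM ler_nat -mulnA.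
exact: binomial_entropy_ge.
Qed.

Lemma H_rate beta p x : H beta p x = beta * x ^+ p - rate x.
Proof. by []. Qed.

(** Since [H] is energy minus [rate], the binomial coefficient is paired with the factor that
    [bin_le] and [bin_ge] compare to [2 ^ n], up to [n + 1]. *)
Lemma sum_weight_npos beta p n k : (0 < n)%N ->
  \sum_(s : config n | npos s == k) weight beta p s =
  'C(n, k)%:R * expR (n%:R * rate (lattice n k)) * expR (n%:R * H beta p (lattice n k)).
Proof.
move=> n0; rewrite -mulrA -expRD H_rate -mulrDr addrC subrK.
under eq_bigr => s /eqP sk do rewrite weightE// mean_lattice sk.
rewrite sumr_const -(card_npos n k) -[LHS]mulr_natl.
by congr (_%:R * _); apply: eq_card => s; rewrite !inE.
Qed.

Lemma sum_weight_le beta p n (A : pred (config n)) h : (0 < n)%N ->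
  (forall s, A s -> H beta p (mean s) <= h) ->
  \sum_(s | A s) weight beta p s <= n.+1%:R * (2 ^+ n * expR (n%:R * h)).
Proof.
move=> n0 Ah.
rewrite (partition_big (fun s : config n => inord (npos s) : 'I_n.+1) predT)//=.
rewrite mulr_natl -[n.+1 in leRHS]card_ord -sumr_const; apply: ler_sum => k _.
(* A level that misses [A] contributes 0; on any other, one element of [A] bounds [H] for the whole
   level, as the mean is constant there. *)
have [/existsP[s /andP[As /eqP sk]]|] :=
  boolP [exists s, A s && (inord (npos s) == k :> 'I_n.+1)]; last first.
  move=> /existsPn no; rewrite big1 ?mulr_ge0 ?exprn_ge0 ?expR_ge0// => s As.
  by have := no s; rewrite As.
have {}sk : npos s = k by rewrite -sk inordK// ltnS npos_le.
have kn : (k <= n)%N by rewrite -ltnS.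
apply: (@le_trans _ _ (\sum_(t : config n | npos t == k) weight beta p t)).
  rewrite big_mkcond [leRHS]big_mkcond; apply: ler_sum => t _.
  case: ifP => [/andP[_ /eqP <-]|_]; first by rewrite inordK ?eqxx// ltnS npos_le.
  by case: ifP => // _; exact: expR_ge0.
rewrite sum_weight_npos// ler_pM ?mulr_ge0 ?expR_ge0// ?bin_le//.
by rewrite ler_expR ler_pM2l ?ltr0n// -sk -mean_lattice Ah.
Qed.

Lemma sum_weight_ge beta p n k (A : pred (config n)) : (0 < n)%N ->
  (k <= n)%N -> (forall s, npos s = k -> A s) ->
  2 ^+ n * expR (n%:R * H beta p (lattice n k)) <=
    n.+1%:R * \sum_(s | A s) weight beta p s.
Proof.
move=> n0 kn kA.
apply: (@le_trans _ _ (n.+1%:R * \sum_(t : config n | npos t == k) weight beta p t)).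
  by rewrite sum_weight_npos// 2!mulrA ler_pM2r ?expR_gt0// bin_ge.
rewrite ler_pM2l ?ltr0n// big_mkcond [leRHS]big_mkcond; apply: ler_sum => t _.
case: ifP => [/eqP tk|_]; first by rewrite kA.
by case: ifP => // _; exact: expR_ge0.
Qed.

(** * Probabilities as ratios of sums of weights, and exponential bounds *)

Lemma PrE beta p n (A : pred (config n)) :
  Pr beta p A = (\sum_(s | A s) weight beta p s) / \sum_(s : config n) weight beta p s.
Proof.
rewrite mulr_suml; apply: eq_bigr => s _.
by rewrite /Defs.pmf /Z_ mulVKf// expf_neq0// pnatr_eq0.
Qed.

Lemma sum_weight_gt0 beta p n : 0 < \sum_(s : config n) weight beta p s.
Proof.
rewrite (bigD1 [ffun=> true])//= ltr_wpDr ?expR_gt0//.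
by apply: sumr_ge0 => s _; exact: expR_ge0.
Qed.

Lemma Pr_ge0 beta p n (A : pred (config n)) : 0 <= Pr beta p A.
Proof.
by rewrite PrE divr_ge0// sumr_ge0// => s _; exact: expR_ge0.
Qed.

Lemma le_Pr beta p n (A B : pred (config n)) :
  (forall s, A s -> B s) -> Pr beta p A <= Pr beta p B.
Proof.
move=> AB; rewrite !PrE ler_pM2r ?invr_gt0 ?sum_weight_gt0//.
rewrite big_mkcond [leRHS]big_mkcond; apply: ler_sum => s _.
case: ifP => [/AB ->//|_]; case: ifP => // _; exact: expR_ge0.
Qed.

Lemma Pr_predT beta p n : Pr beta p (@predT (config n)) = 1.
Proof. by rewrite PrE divff// lt0r_neq0 ?sum_weight_gt0. Qed.

Lemma PrC beta p n (A : pred (config n)) :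
  1 - Pr beta p A = Pr beta p (fun s => ~~ A s).
Proof.
by rewrite -(Pr_predT beta p n) /Pr (bigID A predT)/= addrAC subrr add0r.
Qed.

Lemma le_Pr_predU beta p n (A B : pred (config n)) :
  Pr beta p (predU A B) <= Pr beta p A + Pr beta p B.
Proof.
rewrite !PrE -mulrDl ler_pM2r ?invr_gt0 ?sum_weight_gt0//.
rewrite big_mkcond [X in _ <= X + _]big_mkcond [X in _ <= _ + X]big_mkcond.
rewrite -big_split; apply: ler_sum => s _ /=.
have := expR_ge0 (beta * n%:R ^ (1 - p%:Z)
        * \sum_(i : {ffun 'I_p -> 'I_n}) \prod_(k < p) spin s (i k)).
rewrite -/(weight _ _ _) => w0.
by case: (A s); case: (B s) => /=; rewrite ?addr0 ?add0r// lerDl.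
Qed.

(** The normalizing sum is bounded below by its level [k] alone; [k] stays free, to be chosen with
    [lattice n k] near a maximizer of [H]. *)
Lemma Pr_le_expR beta p n k (A : pred (config n)) h : (0 < n)%N -> (k <= n)%N ->
  (forall s, A s -> H beta p (mean s) <= h) ->
  Pr beta p A <= n.+1%:R ^+ 2 * expR (n%:R * (h - H beta p (lattice n k))).
Proof.
move=> n0 kn Ah; rewrite PrE ler_pdivrMr ?sum_weight_gt0//.
have S_ge : 2 ^+ n * expR (n%:R * H beta p (lattice n k)) <=
    n.+1%:R * \sum_(s : config n) weight beta p s by exact: sum_weight_ge.
have T_le := sum_weight_le beta p n A h n0 Ah.
rewrite mulrBr expRB.
set f := expR (_ * h) in T_le *; set e := expR (_ * H _ _ _) in S_ge *.
have e0 : 0 < e := expR_gt0 _.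
set S := \sum_s _ in S_ge *; set T := \sum_(s | _) _ in T_le *.
apply: (le_trans T_le).
rewrite (_ : n.+1%:R * (2 ^+ n * f) = n.+1%:R * f / e * (2 ^+ n * e)); last first.
  by field; exact: lt0r_neq0.
rewrite (_ : _ * S = n.+1%:R * f / e * (n.+1%:R * S)); last by field; exact: lt0r_neq0.
by rewrite ler_pM2l// !mulr_gt0 ?ltr0n ?invr_gt0 ?expR_gt0.
Qed.

Lemma Pr_ge_expR beta p n k (A : pred (config n)) h : (0 < n)%N -> (k <= n)%N ->
  (forall s : config n, H beta p (mean s) <= h) -> (forall s, npos s = k -> A s) ->
  expR (n%:R * (H beta p (lattice n k) - h)) <= n.+1%:R ^+ 2 * Pr beta p A.
Proof.
move=> n0 kn Hh kA; rewrite PrE mulrA ler_pdivlMr ?sum_weight_gt0//.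
have S_le : \sum_(s : config n) weight beta p s <=
    n.+1%:R * (2 ^+ n * expR (n%:R * h)) by exact: sum_weight_le.
have T_ge := sum_weight_ge beta p n k A n0 kn kA.
rewrite mulrBr expRB.
set f := expR (_ * h) in S_le *; set e := expR (_ * H _ _ _) in T_ge *.
have f0 : 0 < f := expR_gt0 _.
set S := \sum_s _ in S_le *; set T := \sum_(s | _) _ in T_ge *.
rewrite -(@ler_pM2l _ (2 ^+ n)) ?exprn_gt0//.
have c0 : 0 <= e / f by rewrite divr_ge0 ?expR_ge0.
apply: (@le_trans _ _ (2 ^+ n * (e / f * (n.+1%:R * (2 ^+ n * f))))).
  by rewrite ler_pM2l ?exprn_gt0// ler_wpM2l.
rewrite (_ : 2 ^+ n * (e / f * (n.+1%:R * (2 ^+ n * f))) =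
    n.+1%:R * 2 ^+ n * (2 ^+ n * e)); last first.
  by field; exact: lt0r_neq0.
rewrite (_ : _ * (_ * T) = n.+1%:R * 2 ^+ n * (n.+1%:R * T)); last by ring.
by rewrite ler_wpM2l// mulr_ge0 ?exprn_ge0.
Qed.

End Configurations.

(** * The functions H and g *)

Section Entropy.
Context {R : realType}.
Implicit Types (beta h x y : R) (p n k : nat).

(** This is [ln t <= t - 1] at [t = 1 / sqrt y]. It controls [y ln y] at 0 and yields the quadratic
    bound on [rate]. *)
Lemma xlnx_ge y : 0 <= y -> 2 * (y - Num.sqrt y) <= y * ln y.
Proof.
rewrite le_eqVlt => /predU1P[<-|y0]; first by rewrite sqrtr0 mul0r subr0 mulr0.
have := sqr_sqrtr (ltW y0); have := y0; rewrite -sqrtr_gt0.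
set a := Num.sqrt y => a0 <-; rewrite lnXn//.
have : ln (1 + (a^-1 - 1)) <= a^-1 - 1.
  by apply: le_ln1Dx; rewrite ltrBrDr addNr invr_gt0.
rewrite addrC subrK lnV// => lna.
have : 1 - a^-1 <= ln a by lra.
rewrite -(ler_pM2l (exprn_gt0 2 a0)) mulrBr mulr1 {2}expr2 mulfK ?lt0r_neq0//.
rewrite mulr2n; lra.
Qed.

Lemma xlnx_le0 y : y <= 1 -> y * ln y <= 0.
Proof.
move=> y1; case: (leP 0 y) => y0; last by rewrite ln0 ?mulr0// ltW.
by rewrite mulr_ge0_le0// ln_le0.
Qed.

Lemma xlnx_continuous : continuous (fun y : R => y * ln y).
Proof.
move=> y; case: (ltgtP y 0) => y0.
(* At negative arguments [ln] is 0 by convention; only the point 0 needs an estimate. *)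
- rewrite /continuous_at (ln0 (ltW y0)) mulr0.
  apply: cvg_near_cst.
  near=> z; rewrite ln0 ?mulr0// ltW//.
  by near: z; exact: lt_nbhsl.
- by apply: cvgM; [exact: cvg_id|exact: continuous_ln].
- rewrite /continuous_at y0 mul0r; apply/cvgrPdist_lt => e e0.
  near=> z.
  rewrite sub0r normrN.
  case: (leP z 0) => z0; first by rewrite ln0// mulr0 normr0.
  have z1 : z < 1 by near: z; apply: lt_nbhsl.
  have ze : Num.sqrt z < e / 2.
    rewrite -[ltRHS]ger0_norm ?divr_ge0 ?ltW// -sqrtr_sqr ltr_sqrt ?exprn_gt0 ?divr_gt0//.
    by near: z; apply: lt_nbhsl; rewrite exprn_gt0 ?divr_gt0.
  rewrite ler0_norm ?xlnx_le0 ?ltW//.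
  have := xlnx_ge z (ltW z0); lra.
Unshelve. all: by end_near.
Qed.

Lemma rate_continuous : continuous (@rate R).
Proof.
move=> x; apply: cvgM; first exact: cvg_cst.
apply: cvgD.
  apply: (@continuous_comp _ _ _ (fun x : R => 1 + x) (fun y => y * ln y)).
    by apply: cvgD; [exact: cvg_cst|exact: cvg_id].
  exact: xlnx_continuous.
apply: (@continuous_comp _ _ _ (fun x : R => 1 - x) (fun y => y * ln y)).
  by apply: cvgB; [exact: cvg_cst|exact: cvg_id].
exact: xlnx_continuous.
Qed.

Lemma H_continuous beta p : continuous (H beta p).
Proof.
move=> x; apply: cvgB; last exact: rate_continuous.
by apply: cvgM; [exact: cvg_cst|exact: exprn_continuous].
Qed.

(** With [a = sqrt (1 + x)] and [b = sqrt (1 - x)], [xlnx_ge] gives [rate x >= 2 - (a + b)]. Then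
    [a b <= 1 - x^2 / 2] yields [(a + b)^2 <= 4 - x^2]. *)
Lemma rate_ge x : -1 <= x <= 1 -> x ^+ 2 / 4 <= rate x.
Proof.
move=> /andP[x1 x2].
have p1 : 0 <= 1 + x by lra.
have p2 : 0 <= 1 - x by lra.
have := xlnx_ge _ p1; have := xlnx_ge _ p2; rewrite /rate.
have := sqr_sqrtr p1; have := sqr_sqrtr p2.
have := sqrtr_ge0 (1 + x); have := sqrtr_ge0 (1 - x).
set a := Num.sqrt (1 + x); set b := Num.sqrt (1 - x) => b0 a0 eb ea lb la.
suff : a + b <= 2 - x ^+ 2 / 4 by lra.
have x21 : x ^+ 2 <= 1 by nra.
have abE : (a * b) ^+ 2 = 1 - x ^+ 2 by rewrite exprMn ea eb; ring.
have ab : a * b <= 1 - x ^+ 2 / 2.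
  have := mulr_ge0 a0 b0; move: abE; set t := a * b => abE t0.
  by case: (leP t (1 - x ^+ 2 / 2)) => // ht; have := sqr_ge0 (x ^+ 2); nra.
have {ab} : (a + b) ^+ 2 <= 4 - x ^+ 2.
  by rewrite sqrrD ea eb mulr2n; lra.
have := addr_ge0 a0 b0; set t := a + b => t0 tE.
by case: (leP t (2 - x ^+ 2 / 4)) => // ht; have := sqr_ge0 (x ^+ 2); nra.
Qed.

Lemma rate_ge0 x : -1 <= x <= 1 -> 0 <= rate x.
Proof. by move=> /rate_ge; apply: le_trans; rewrite divr_ge0 ?sqr_ge0. Qed.

Lemma rateN x : rate (- x) = rate x.
Proof. by rewrite /rate opprK; congr (_ * _); rewrite addrC. Qed.

Lemma H_at0 beta p : (0 < p)%N -> H beta p 0 = 0.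
Proof. by move=> p0; rewrite /H expr0n gtn_eqF//= addr0 subr0 ln1; ring. Qed.

Lemma H_at1 beta p : H beta p 1 = beta - ln 2.
Proof. by rewrite /H expr1n subrr mul0r; field. Qed.

Lemma H_le_norm beta p x : 0 <= beta -> H beta p x <= H beta p `|x|.
Proof.
move=> b0; rewrite !H_rate -normrX.
have -> : rate `|x| = rate x by case: (ler0P x) => // _; rewrite rateN.
by rewrite lerD2r ler_wpM2l// ler_norm.
Qed.

(* [eps := 2 exp (- 2 beta p)] is where the entropy gain
   [eps ln (2 / eps) / 2] dominates the linear energy loss [beta p eps]. *)
Lemma H1_not_max beta p : (0 < p)%N -> ln 2 < beta ->
  exists2 x, -1 <= x <= 1 & H beta p 1 < H beta p x.
Proof.
move=> p0 lb.
have b0 : 0 < beta by rewrite (lt_trans _ lb)// ln_gt0// ltr1n.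
have pR : 1 <= p%:R :> R by rewrite ler1n.
have ln2 : 2^-1 <= ln 2 :> R.
  have : ln (1 + (- 2^-1)) <= - 2^-1 :> R by apply: le_ln1Dx; lra.
  rewrite (_ : 1 + _ = 2^-1); last by field.
  rewrite lnV ?posrE//; lra.
pose e := 2 * expR (- (2 * beta * p%:R)).
have e0 : 0 < e by rewrite mulr_gt0 ?expR_gt0.
have lne : ln e = ln 2 - 2 * beta * p%:R.
  by rewrite lnM ?posrE ?expR_gt0// expRK.
have e1 : e < 1.
  rewrite -ltr_ln ?posrE// lne ln1; nra.
exists (1 - e); first by apply/andP; split; lra.
rewrite H_at1 /H.
have -> : 1 + (1 - e) = 2 - e by ring.
have -> : 1 - (1 - e) = e by ring.
(* Bernoulli's inequality. *)
have pw : 1 - p%:R * e <= (1 - e) ^+ p.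
  elim: (p) => [|q IH]; first by rewrite mul0r subr0 expr0.
  rewrite exprS -natr1.
  have : (1 - e) * (1 - q%:R * e) <= (1 - e) * (1 - e) ^+ q.
    by rewrite ler_wpM2l//; lra.
  apply: le_trans; have : 0 <= q%:R * (e * e) by rewrite !mulr_ge0// ltW.
  by nra.
have l2e : ln (2 - e) < ln 2 by rewrite ltr_ln ?posrE//; lra.
have h1 : (2 - e) * ln (2 - e) < (2 - e) * ln 2 by rewrite ltr_pM2l//; lra.
have h2 : beta * (1 - p%:R * e) <= beta * (1 - e) ^+ p by rewrite ler_pM2l.
(* By the choice of [e] the terms in [beta p e] cancel; strictness comes from
   [ln (2 - e) < ln 2]. *)
have h3 : e * ln e = e * ln 2 - 2 * beta * p%:R * e by rewrite lne; ring.
rewrite h3.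
have := mulr_gt0 e0 b0; lra.
Qed.

(** The map [g], with real values; it represents the estimator for means other than 0, 1 and -1. *)
Definition mple p x : R := p%:R^-1 * x ^- p.-1 * atanh x.

Lemma atanhE x : -1 < x < 1 -> atanh x = 2^-1 * (ln (1 + x) - ln (1 - x)).
Proof.
by move=> /andP[x1 x2]; rewrite /atanh ln_div// posrE; lra.
Qed.

Lemma is_derive_H beta p x : -1 < x < 1 ->
  is_derive x 1 (H beta p) (beta * (p%:R * x ^+ p.-1) - atanh x).
Proof.
move=> x11; have /andP[x1 x2] := x11.
have p1 : 0 < 1 + x by lra.
have p2 : 0 < 1 - x by lra.
have xlnxD y : 0 < y -> is_derive y 1 (fun y : R => y * ln y) (ln y + 1).
  move=> y0; have dl := is_derive1_ln y0.
  apply: is_derive_eq; rewrite /GRing.scale/= mulfV ?lt0r_neq0//; ring.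
have d1 : is_derive x 1 (fun x : R => (1 + x) * ln (1 + x)) (ln (1 + x) + 1).
  have dx : is_derive x 1 (fun x : R => 1 + x) 1.
    by apply: is_derive_eq; ring.
  have := @is_derive1_comp _ (fun y : R => y * ln y)
    (fun x : R => 1 + x) x _ _ (xlnxD _ p1) dx.
  by rewrite mulr1.
have d2 : is_derive x 1 (fun x : R => (1 - x) * ln (1 - x)) (- (ln (1 - x) + 1)).
  have dx : is_derive x 1 (fun x : R => 1 - x) (-1).
    by apply: is_derive_eq; ring.
  have := @is_derive1_comp _ (fun y : R => y * ln y)
    (fun x : R => 1 - x) x _ _ (xlnxD _ p2) dx.
  by rewrite mulrN1.
have d3 : is_derive x 1 (fun x : R => x ^+ p) (p%:R * x ^+ p.-1).
  have := is_deriveX p (is_derive_id x (1 : R)).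
  by rewrite /GRing.scale/= mulr1 exprfctE.
rewrite /H; apply: is_derive_eq.
by rewrite atanhE// /GRing.scale/=; ring.
Qed.

(** Both signs are allowed: for even [p] the nonzero maximizers come in opposite pairs, and the mean
    may be near either one. *)
Definition global_max beta p x : Prop :=
  -1 <= x <= 1 /\ forall y, -1 <= y <= 1 -> H beta p y <= H beta p x.

Lemma global_max_exists beta p : exists x, global_max beta p x.
Proof.
have [|c cI cmax] := @EVT_max _ (H beta p) (-1) 1 ltac:(lra).
  by apply: continuous_subspaceT => x; exact: H_continuous.
exists c; split; first by move: cI; rewrite in_itv.
by move=> y yI; apply: cmax; rewrite in_itv.
Qed.

(** As [beta > ln 2], [H beta p 1] is positive, which rules out 0. [H1_not_max] rules out 1, and
    also -1, where [H] is no larger. At an interior maximizer the derivative vanishes. *)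
Lemma global_max_mple beta p x : (0 < p)%N -> ln 2 < beta -> global_max beta p x ->
  [/\ -1 < x < 1, x != 0 & mple p x = beta].
Proof.
move=> p0 lb [/andP[x1 x2] xmax].
have b0 : 0 < beta by rewrite (lt_trans _ lb)// ln_gt0// ltr1n.
have [y y11 H1y] := H1_not_max beta p p0 lb.
have H1x : H beta p 1 < H beta p x by apply: lt_le_trans H1y (xmax _ y11).
have x_neq1 : x != 1 by apply: contraTneq H1x => ->; rewrite ltxx.
have x_neqN1 : x != -1.
  apply: contraTneq H1x => ->; rewrite -leNgt.
  by have := H_le_norm beta p (-1) (ltW b0); rewrite normrN1.
have x_neq0 : x != 0.
  by apply: contraTneq H1x => ->; rewrite H_at0// H_at1 -leNgt subr_ge0 ltW.
have x11 : -1 < x < 1 by rewrite !lt_neqAle x1 x2 x_neq1 eq_sym x_neqN1.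
split => //.
have : is_derive x 1 (H beta p) 0.
  apply: (@derive1_at_max _ _ (-1) 1); first lra.
  - by move=> t; rewrite in_itv => t11; have [] := is_derive_H beta p t t11.
  - by rewrite in_itv.
  - by move=> t; rewrite in_itv => /andP[t1 t2]; apply: xmax; rewrite !ltW.
move=> /@derive_val; have [_ ->] := is_derive_H beta p x x11.
move=> /eqP; rewrite subr_eq0 /mple => /eqP <-.
by field; rewrite expf_neq0//= pnatr_eq0 -lt0n.
Qed.

Lemma mple_continuous p x : -1 < x < 1 -> x != 0 -> {for x, continuous (mple p)}.
Proof.
move=> /andP[x1 x2] x0; apply: cvgM.
  apply: cvgM; first exact: cvg_cst.
  by apply: cvgV; [rewrite expf_neq0|exact: exprn_continuous].
apply: cvgM; first exact: cvg_cst.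
have p2 : 1 - x != 0 by rewrite subr_eq0 gt_eqF.
have cf : {for x, continuous (fun x : R => (1 + x) / (1 - x))}.
  apply: cvgM; first by apply: cvgD; [exact: cvg_cst|exact: cvg_id].
  by apply: cvgV => //; apply: cvgB; [exact: cvg_cst|exact: cvg_id].
apply: (continuous_comp cf); apply: continuous_ln.
by rewrite divr_gt0//; lra.
Qed.

Lemma mple_bounded beta p : (3 <= p)%N -> 0 <= beta < ln 2 ->
  exists M, forall x, -1 <= x <= 1 -> 0 < H beta p x ->
    [/\ -1 < x < 1, x != 0 & mple p x <= M].
Proof.
move=> hp /andP[b0 bl].
have b1 : beta <= 1.
  have : ln (1 + 1) <= 1 :> R by apply: le_ln1Dx; lra.
  by rewrite -[1 + 1]/(2 : R); lra.
(* Near 0 the energy is at most [|x|^3], as [p >= 3] and [beta <= 1], whereas [rate] is at least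
   [x^2 / 4]; hence the radius 1/4. *)
have out x : -1 <= x <= 1 -> 0 <= H beta p x -> `|x| < 4^-1 -> x = 0.
  move=> x11 Hx x4.
  apply/eqP; rewrite -normr_eq0; apply: contraTT Hx => x_neq0; rewrite -ltNge.
  have x_gt0 : 0 < `|x| by rewrite lt_def x_neq0 normr_ge0.
  apply: le_lt_trans (H_le_norm beta p x b0) _; rewrite H_rate.
  have := @rate_ge `|x| ltac:(rewrite (le_trans (lerN10 _))//= ler_norml x11).
  have xp : `|x| ^+ p <= `|x| ^+ 3 by rewrite ler_wiXn2l//; lra.
  have : beta * `|x| ^+ p <= 1 * `|x| ^+ 3 by rewrite ler_pM ?exprn_ge0.
  have : 0 < `|x| ^+ 2 * (4^-1 - `|x|) by rewrite mulr_gt0 ?exprn_gt0// subr_gt0.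
  rewrite exprS; lra.
have inside x : -1 <= x <= 1 -> 0 <= H beta p x -> -1 < x < 1.
  move=> /[dup] /andP[x1 x2] x11 Hx.
  have x_neq : `|x| != 1.
    apply: contraTneq (le_trans Hx (H_le_norm beta p x b0)) => ->.
    by rewrite H_at1 -ltNge; lra.
  by rewrite -ltr_norml lt_neqAle x_neq ler_norml.
(* The condition [0 <= H] is not strict, so that [K] is compact; [mple p] is continuous on it. *)
pose K : set R :=
  (`[-1, 1] `&` ([set x | 4^-1 <= `|x|] `&` [set x | 0 <= H beta p x]))%classic.
have inK x : K x -> -1 < x < 1 /\ x != 0.
  rewrite /K /= in_itv => -[x11 [x4 Hx]]; split; first exact: inside.
  by rewrite -normr_gt0; lra.
have pos x : -1 <= x <= 1 -> 0 < H beta p x -> K x.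
  move=> x11 Hx; split; first by rewrite /= in_itv.
  split; last exact: ltW.
  rewrite /= leNgt; apply/negP => /(out _ x11 (ltW Hx)) x0.
  by move: Hx; rewrite x0 H_at0 ?ltxx// (leq_trans _ hp).
have cK : compact K.
  apply: (subclosed_compact _ (@segment_compact R (-1) 1)); last exact: subIsetl.
  apply: closedI; first exact: interval_closed.
  apply: closedI.
    apply: (@preimage_closed _ _ (fun x : R => `|x|) _ _ (closed_ge (y := 4^-1))).
    by move=> x _; exact: norm_continuous.
  apply: (@preimage_closed _ _ (H beta p) _ _ (closed_ge (y := 0))).
  by move=> x _; exact: H_continuous.
have [K0|/set0P/negP/negPn/eqP K0] := pselect (K !=set0)%classic.
  have [|c cK' cmax] := @compact_EVT_max _ _ (mple p) K K0 cK.
    apply: continuous_in_subspaceT => x; rewrite inE => /inK[].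
    exact: mple_continuous.
  exists (mple p c) => x x11 Hx; have Kx := pos x x11 Hx.
  by have [? ?] := inK x Kx; split => //; apply: cmax; rewrite inE.
exists 0 => x x11 Hx; have := pos x x11 Hx.
by rewrite K0.
Qed.

(** The complement of [U] in [-1, 1] is compact, and the maximum of [H] on it cannot be global. *)
Lemma H_gap beta p (U : set R) x : open U -> (forall y, global_max beta p y -> U y) ->
  global_max beta p x ->
  exists2 h, h < H beta p x & forall y, -1 <= y <= 1 -> ~ U y -> H beta p y <= h.
Proof.
move=> oU maxU [x11 xmax].
pose K : set R := (`[-1, 1] `&` ~` U)%classic.
have cK : compact K.
  apply: (subclosed_compact _ (@segment_compact R (-1) 1)); last exact: subIsetl.
  by apply: closedI; [exact: interval_closed|exact: open_closedC].
have [K0|/set0P/negP/negPn/eqP K0] := pselect (K !=set0)%classic; last first.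
  exists (H beta p x - 1); first lra.
  move=> y y11 Uy; have : K y by split => //=; rewrite in_itv.
  by rewrite K0.
have [|c] := @compact_EVT_max _ _ (H beta p) K K0 cK.
  by apply: continuous_subspaceT => y; exact: H_continuous.
rewrite inE => -[/=]; rewrite in_itv => /= c11 Uc cmax.
exists (H beta p c).
  rewrite lt_neqAle xmax// andbT; apply: contra_not_neq Uc => cx.
  by apply: maxU; split => // y y11; rewrite cx xmax.
by move=> y y11 Uy; apply: cmax; rewrite inE; split => //=; rewrite in_itv.
Qed.

Lemma near_lattice_H beta p x (e : R) : -1 <= x <= 1 -> 0 < e ->
  \forall n \near \oo%classic,
    exists2 k, (k <= n)%N & H beta p x - e < H beta p (lattice n k).
Proof.
move=> x11 e0.
have /cvgrPdist_lt/(_ e e0) := H_continuous beta p x.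
move=> /nbhs_ballP[d /= d0 Hd]; near=> n.
have n0 : (0 < n)%N by near: n; exists 1%N.
have nR : 0 < n%:R :> R by rewrite ltr0n.
have nd : 2 < d * n%:R.
  rewrite mulrC -ltr_pdivrMr//; near: n; exact: nbhs_infty_gtr.
have z0 : 0 <= n%:R * (1 + x) / 2 by rewrite divr_ge0// mulr_ge0//; lra.
(* Lattice points are [2 / n] apart; rounding [n (1 + x) / 2] down gives one within [2 / n] of
   [x]. *)
have /andP[k1 k2] := truncn_itv z0.
set k := Num.truncn _ in k1 k2.
exists k.
  rewrite -(ler_nat R) (le_trans k1)//; have := ler_pM2l nR (1 + x) 2; nra.
have : `|H beta p x - H beta p (lattice n k)| < e.
  apply: Hd; rewrite /ball/= /lattice.
  have -> : x - (2 * k%:R - n%:R) / n%:R = (n%:R * (1 + x) - 2 * k%:R) / n%:R.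
    by field; exact: lt0r_neq0.
  rewrite ltr_norml ltr_pdivlMr// ltr_pdivrMr//.
  by move: k2; rewrite -[k.+1%:R]natr1 => k2; apply/andP; split; lra.
by rewrite ltr_norml => /andP[]; lra.
Unshelve. all: by end_near.
Qed.

(** From [atanh x >= x / 4] and [p - 1 >= 2]: the estimator diverges at 0 from the right. *)
Lemma mple_ge p x : (3 <= p)%N -> 0 < x < 1 -> (4 * p%:R * x)^-1 <= mple p x.
Proof.
move=> hp /andP[x0 x1]; have pR : 0 < p%:R :> R by rewrite ltr0n (leq_trans _ hp).
have ax : x / 4 <= atanh x.
  have : ln (1 + (- x)) <= - x by apply: le_ln1Dx; lra.
  rewrite atanhE; last by apply/andP; split; lra.
  have := @ln_ge0 R (1 + x); lra.
have xp : x ^- 2 <= x ^- p.-1.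
  rewrite lef_pV2 ?posrE ?exprn_gt0//.
  by rewrite ler_wiXn2l// ?ltW//; lia.
rewrite /mple (_ : _^-1 = p%:R^-1 * x ^- 2 * (x / 4)); last first.
  by field; rewrite !lt0r_neq0.
have x_ge0 := ltW x0.
by rewrite ler_pM ?ler_pM2l ?divr_ge0 ?invr_ge0 ?invr_gt0 ?ler0n ?exprn_ge0.
Qed.

End Entropy.

(** * Bahadur slope *)

Section Slope.
Context {R : realType}.
Implicit Types (beta h x y e K M : R) (p n k : nat).

(* Otherwise simplification unfolds lne on real arguments, out of reach of
   lne_EFin. *)
Arguments lne : simpl never.

Lemma mean_itv n (s : config n) : -1 <= (mean s : R) <= 1.
Proof.
rewrite mean_lattice /lattice.
have := npos_le n s; rewrite -(ler_nat R) => kn.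
have [n0|n0] := posnP n.
  have -> : n%:R^-1 = 0 :> R by rewrite n0 invr0.
  by rewrite mulr0; apply/andP; split; lra.
rewrite ler_pdivlMr ?ltr0n// ler_pdivrMr ?ltr0n//.
have := ler0n R (npos s); lra.
Qed.

Lemma beta_MPLE p n (s : config n) : (0 < p)%N -> -1 < (mean s : R) < 1 ->
  mean s != 0 :> R -> beta_MPL p s = (mple p (mean s : R))%:E.
Proof.
move=> p0 /andP[x1 x2] x0; rewrite /beta_MPL (negbTE x0) /eatanh.
rewrite lt_eqF// gt_eqF// -EFinM /mple; congr (_ * _ * _)%:E.
by case: p p0 => // p _; rewrite intS opprD addNKr -exprnN.
Qed.

(** [T_stat] is an increasing function of the estimator, and the complement of [<=] is strict
    excess. *)
Lemma L_statE (beta0 : R) p n (s : config n) : (0 < n)%N ->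
  L_stat beta0 p s =
  Pr beta0 p [pred t : config n | (@beta_MPL R p n s < beta_MPL p t)%E].
Proof.
move=> n0; rewrite /L_stat /cdf_T PrC; congr (\sum_(t | _) _).
apply/funext => t /=; rewrite -ltNge /T_stat.
by rewrite lte_pmul2l ?lte_fin ?sqrtr_gt0 ?ltr0n// lteD2rE.
Qed.

Lemma near_poly_le_exp e : 0 < e ->
  \forall n \near \oo%classic, n.+1%:R ^+ 2 <= expR (n%:R * e).
Proof.
move=> e0; near=> n.
have n1 : 1 <= n%:R :> R by rewrite ler1n; near: n; exists 1%N.
(* [(n + 1)^2 <= 4 n^2], and the cubic term of the exponential is [(n e)^3 / 6], whence
   [24 = 4 * 6]. *)
have ne : 24 / e ^+ 3 < n%:R by near: n; exact: nbhs_infty_gtr.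
rewrite ltr_pdivrMr ?exprn_gt0// in ne.
have ne0 : 0 <= n%:R * e by rewrite mulr_ge0// ltW.
apply: le_trans (expR_ge1Dxn 2 ne0); rewrite -natr1 exprMn.
have -> : 3`!%:R = 6 :> R by [].
have : 0 <= n%:R ^+ 2 * (n%:R * e ^+ 3 - 24) :> R.
  by rewrite mulr_ge0// subr_ge0 ltW.
nra.
Unshelve. all: by end_near.
Qed.

Lemma near_exp_lt e h : 0 < e -> 0 < h ->
  \forall n \near \oo%classic, expR (- (n%:R * e)) < h.
Proof.
move=> e0 h0; near=> n.
rewrite expRN invf_plt ?posrE ?expR_gt0//.
have : (h^-1 - 1) / e < n%:R by near: n; exact: nbhs_infty_gtr.
rewrite ltr_pdivrMr// => hn.
by apply: lt_le_trans (expR_ge1Dx _); lra.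
Unshelve. all: by end_near.
Qed.

(** Typical means. Above [M], a larger estimate forces [H beta0 p <= 0]; below [K], the estimate is
    exceeded at small positive means. *)
Definition regular p M K x : bool :=
  [&& -1 < x < 1, x != 0 & M < mple p x < K].

Lemma regular_open p M K : open [set x | regular p M K x]%classic.
Proof.
rewrite openE => x /and3P[/andP[x1 x2] x0 /andP[xM xK]].
have c : {for x, continuous (mple p)} by apply: mple_continuous; rewrite ?x1.
rewrite /interior /=; near=> y.
apply/and3P; split.
- by apply/andP; split; near: y; [exact: lt_nbhsr|exact: lt_nbhsl].
- by near: y; apply: open_nbhs_nbhs; split => //; exact: open_neq.
- by apply/andP; split; near: y; [exact: (cvgr_gt _ c)|exact: (cvgr_lt _ c)].
Unshelve. all: by end_near.
Qed.

(* The maximizers of H beta p satisfy mple p x = beta, so consistency of the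
   estimator is concentration of the mean at the maximizers. *)
Lemma Pr_irregular beta p M K : (0 < p)%N -> ln 2 < beta -> M < beta < K ->
  ((fun n => Pr beta p [pred s : config n | ~~ regular p M K (mean s)])
    @ \oo --> (0%R : R))%classic.
Proof.
move=> p0 lb /andP[Mb bK].
have [m mmax] := global_max_exists beta p.
have [|h hm hle] := @H_gap R beta p _ m (regular_open p M K) _ mmax.
  move=> y /(global_max_mple _ _ _ p0 lb)[y11 y0 yE].
  by rewrite /= /regular y11 y0 yE Mb.
(* One third of the gap pays for the lattice approximation, one for the polynomial factor, and one
   is left for decay. *)
have d0 : 0 < (H beta p m - h) / 3 by rewrite divr_gt0// subr_gt0.
set d := _ / 3 in d0.
have m11 : -1 <= m <= 1 by case: mmax.
apply/cvgrPdist_lt => e e0; near=> n.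
rewrite sub0r normrN ger0_norm ?Pr_ge0//.
have n0 : (0 < n)%N by near: n; exists 1%N.
have [k kn Hk] : exists2 k, (k <= n)%N & H beta p m - d < H beta p (lattice n k).
  by near: n; exact: near_lattice_H.
apply: le_lt_trans (Pr_le_expR _ _ _ k _ h n0 kn _) _.
  by move=> s /= /negP s_irr; apply: hle => //; exact: mean_itv.
apply: (@le_lt_trans _ _ (expR (n%:R * d) * expR (n%:R * (- (2 * d))))).
  rewrite ler_pM ?exprn_ge0 ?expR_ge0//; first by near: n; exact: near_poly_le_exp.
  by rewrite ler_expR ler_pM2l ?ltr0n//; move: Hk; rewrite /d; lra.
rewrite -expRD (_ : _ + _ = - (n%:R * d)); last by ring.
by near: n; exact: near_exp_lt.
Unshelve. all: by end_near.
Qed.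

Lemma near_div_lt e : 0 < e -> \forall n \near \oo%classic, 2 / n%:R < e.
Proof.
move=> e0; near=> n.
have n0 : 0 < n%:R :> R by rewrite ltr0n; near: n; exists 1%N.
rewrite ltr_pdivrMr// mulrC -ltr_pdivrMr//.
by near: n; exact: nbhs_infty_gtr.
Unshelve. all: by end_near.
Qed.

(* The estimator also blows up at small positive means, where H vanishes;
   this is where the dominant part of the tail of T_stat sits. *)
Lemma near_lattice_tail beta p K e : (3 <= p)%N -> 0 < e ->
  \forall n \near \oo%classic, exists k, [/\ (k <= n)%N,
    0 < (lattice n k : R) < 1, K < mple p (lattice n k) & - e < H beta p (lattice n k)].
Proof.
move=> hp e0.
have p_gt0 : (0 < p)%N by rewrite (leq_trans _ hp).
have pR : 0 < p%:R :> R by rewrite ltr0n.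
(* Below [1 / (4 p (|K| + 1))], [mple_ge] gives a value above [|K| + 1], hence above [K]. *)
have K1 : 0 < 4 * p%:R * (`|K| + 1) by rewrite !mulr_gt0 ?ltr_wpDl.
have K2 : 0 < 1 / (4 * p%:R * (`|K| + 1)) by rewrite divr_gt0.
have /cvgrPdist_lt/(_ e e0)/nbhs_ballP[d /= d0 Hd] := H_continuous beta p 0.
near=> n; have n3 : (2 < n)%N by near: n; exists 3%N.
have n_d : 2 / n%:R < d by near: n; exact: near_div_lt.
have n_K : 2 / n%:R < 1 / (4 * p%:R * (`|K| + 1)) by near: n; exact: near_div_lt.
have n_1 : 2 / n%:R < 1 :> R by near: n; exact: near_div_lt.
have nR : 0 < n%:R :> R by rewrite ltr0n (leq_trans _ n3).
(* This level has the smallest positive mean: [2 / n] for even [n], [1 / n] for odd [n]. *)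
have k1 : (n < 2 * n./2.+1)%N by lia.
have k2 : (2 * n./2.+1 <= n + 2)%N by lia.
have kn : (n./2.+1 <= n)%N by lia.
have x0 : 0 < lattice n n./2.+1 :> R.
  by rewrite /lattice divr_gt0// subr_gt0 -natrM ltr_nat.
have x2n : lattice n n./2.+1 <= 2 / n%:R :> R.
  by rewrite /lattice ler_pM2r ?invr_gt0// lerBlDl -natrM -natrD ler_nat.
set x : R := lattice n _ in x0 x2n.
have x1 : x < 1 by exact: le_lt_trans x2n _.
exists n./2.+1; rewrite -/x; split => //; first by rewrite x0.
  have : x < 1 / (4 * p%:R * (`|K| + 1)).
    by exact: le_lt_trans x2n _.
  rewrite ltr_pdivlMr// => xK; apply: lt_le_trans (mple_ge _ _ hp _); last by rewrite x0.
  apply: (@lt_trans _ _ (`|K| + 1)); first by have := ler_norm K; lra.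
  have px0 : 0 < 4 * p%:R * x by rewrite mulr_gt0// mulr_gt0.
  by rewrite -[ltRHS]mul1r ltr_pdivlMr//; lra.
have : `|H beta p 0 - H beta p x| < e.
  apply: Hd; rewrite /ball/= sub0r normrN gtr0_norm//.
  by exact: le_lt_trans x2n _.
by rewrite H_at0// ltr_norml => /andP[_]; lra.
Unshelve. all: by end_near.
Qed.

(** Both bounds depend on the observation only through [M] and [K], so [n] is chosen uniformly in
    [s]. Of the error [2 e], one [e] comes from the lattice and one from the polynomial factor. *)
Lemma near_log_L_stat (beta0 : R) p M K m e : (3 <= p)%N ->
  (forall x, -1 <= x <= 1 -> 0 < H beta0 p x ->
    [/\ -1 < x < 1, x != 0 & mple p x <= M]) ->
  global_max beta0 p m -> 0 < e ->
  \forall n \near \oo%classic, forall s : config n, regular p M K (mean s) ->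
    0 < L_stat beta0 p s /\
    `|n%:R^-1 * ln (L_stat beta0 p s) + H beta0 p m| <= 2 * e.
Proof.
move=> hp MP [m11 mmax] e0.
have p0 : (0 < p)%N by rewrite (leq_trans _ hp).
near=> n => s /and3P[s11 s0 /andP[sM sK]].
have n0 : (0 < n)%N by near: n; exists 1%N.
have nR : 0 < n%:R :> R by rewrite ltr0n.
have poly : n.+1%:R ^+ 2 <= expR (n%:R * e) by near: n; exact: near_poly_le_exp.
rewrite L_statE//; set L := Pr _ _ _.
have upper : L <= expR (n%:R * (2 * e - H beta0 p m)).
  have [k kn Hk] : exists2 k, (k <= n)%N & H beta0 p m - e < H beta0 p (lattice n k).
    by near: n; exact: near_lattice_H.
  apply: le_trans (Pr_le_expR _ _ _ k _ 0 n0 kn _) _.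
    (* Where [H beta0 p] is positive the estimate is at most [M], hence below the observed one. *)
    move=> t /=; rewrite beta_MPLE// => st; rewrite leNgt; apply/negP => Ht.
    have [t11 t0 tM] := MP _ (mean_itv _ t) Ht.
    by move: st; rewrite beta_MPLE// lte_fin => /(le_lt_trans (ltW sM)); rewrite ltNge tM.
  apply: (@le_trans _ _ (expR (n%:R * e) * expR (n%:R * (e - H beta0 p m)))).
    rewrite ler_pM ?exprn_ge0 ?expR_ge0// ler_expR ler_pM2l//; lra.
  by rewrite -expRD ler_expR -mulrDr ler_pM2l//; lra.
have lower : expR (n%:R * (- (2 * e) - H beta0 p m)) <= L.
  have [k [kn k01 kK Hk]] : exists k, [/\ (k <= n)%N, 0 < (lattice n k : R) < 1,
      K < mple p (lattice n k) & - e < H beta0 p (lattice n k)].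
    by near: n; exact: near_lattice_tail.
  have kL t : npos t = k -> [pred t : config n | (@beta_MPL R p n s < beta_MPL p t)%E] t.
    move=> tk; have /andP[k0 k1] := k01.
    rewrite /= beta_MPLE// beta_MPLE ?mean_lattice ?tk ?gt_eqF//.
      by rewrite lte_fin -mean_lattice; exact: lt_trans kK.
    by rewrite k1 (lt_trans _ k0).
  have := @Pr_ge_expR R beta0 p n k _ (H beta0 p m) n0 kn
    (fun t => mmax _ (mean_itv _ t)) kL.
  rewrite -/L => le_L.
  have L0 : 0 <= L by exact: Pr_ge0.
  rewrite -(@ler_pM2l _ (expR (n%:R * e))) ?expR_gt0//.
  apply: (@le_trans _ _ (n.+1%:R ^+ 2 * L)); last by rewrite ler_wpM2r.
  apply: le_trans le_L; rewrite -expRD ler_expR -mulrDr ler_pM2l//; lra.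
have L0 : 0 < L := lt_le_trans (expR_gt0 _) lower.
split => //.
move: upper lower; rewrite -{1 2}(@lnK _ L) ?posrE// !ler_expR.
rewrite -(ler_pdivrMl _ _ nR) -(ler_pdivlMl _ _ nR) => up lo.
by rewrite ler_norml; apply/andP; split; lra.
Unshelve. all: by end_near.
Qed.

(** For large [n] only irregular configurations can deviate, and their probability tends to 0. *)
Lemma is_bahadur_slope_max (beta0 : R) beta p M m : (3 <= p)%N ->
  (forall x, -1 <= x <= 1 -> 0 < H beta0 p x ->
    [/\ -1 < x < 1, x != 0 & mple p x <= M]) ->
  global_max beta0 p m -> ln 2 < beta -> M < beta ->
  is_bahadur_slope beta0 beta p (2 * H beta0 p m).
Proof.
move=> hp MP mmax lb Mb e e0.
have p0 : (0 < p)%N by rewrite (leq_trans _ hp).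
have bK : M < beta < beta + 1 by rewrite Mb ltrDl ltr01.
have irr := Pr_irregular beta p M (beta + 1) p0 lb bK.
apply: (@squeeze_cvgr _ _ _ _ (fun=> 0) (fun n =>
  Pr beta p [pred s : config n | ~~ regular p M (beta + 1) (mean s)])) => //.
  near=> n; rewrite Pr_ge0/=; apply: le_Pr => s /=; apply: contraTN => sreg.
  have /(_ s sreg)[L0 Le] : forall s : config n, regular p M (beta + 1) (mean s) ->
      0 < L_stat beta0 p s /\
      `|n%:R^-1 * ln (L_stat beta0 p s) + H beta0 p m| <= 2 * (e / 2).
    by near: n; apply: near_log_L_stat; rewrite ?divr_gt0.
  rewrite lne_EFin// -EFinM -EFinB abse_EFin lte_fin -leNgt opprK mulKf//.
  by apply: le_trans Le _; lra.
exact: cvg_cst.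
Unshelve. all: by end_near.
Qed.

(** If [c] and [d] differed, the two deviation events would cover all configurations, though each
    eventually has probability below 1/2. *)
Lemma bahadur_slope_unique (beta0 : R) beta p c d :
  is_bahadur_slope beta0 beta p c -> is_bahadur_slope beta0 beta p d -> c = d.
Proof.
move=> slope_c slope_d; apply/eqP/negP => /negP c_neq_d.
have e0 : 0 < `|c - d| / 8 by rewrite divr_gt0// normr_gt0 subr_eq0.
have half : 0 < 2^-1 :> R by rewrite invr_gt0.
have /cvgrPdist_lt/(_ _ half) Pc := slope_c _ e0.
have /cvgrPdist_lt/(_ _ half) Pd := slope_d _ e0.
have [n [{}Pc {}Pd]] := filter_ex (filterI Pc Pd).
move: Pc Pd; rewrite !sub0r !normrN !(ger0_norm (Pr_ge0 _ _ _ _)).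
set A := [pred s | _]; set B := [pred s | _] => PA PB.
suff : 1 <= Pr beta p A + Pr beta p B by lra.
rewrite -(Pr_predT beta p n); apply: le_trans (le_Pr_predU _ _ _ _ _).
apply: le_Pr => s _ /=; apply/negPn; rewrite negb_or -!leNgt.
(* An infinite value deviates from both limits; a finite one cannot be within [|c - d| / 8] of two
   points [|c - d| / 2] apart. *)
case: ((n%:R^-1)%:E * _)%E => [r| |] //=.
rewrite !lee_fin !opprK; apply/negP => /andP[].
have := e0; case: (ger0P (c - d)) => cd.
  by rewrite !ler_norml => ? /andP[? ?] /andP[? ?]; lra.
by rewrite !ler_norml => ? /andP[? ?] /andP[? ?]; lra.
Qed.

Lemma bahadur_slopeE (beta0 : R) beta p c :
  is_bahadur_slope beta0 beta p c -> bahadur_slope beta0 beta p = c.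
Proof.
move=> slope_c; apply: (@bahadur_slope_unique beta0 beta p) => //.
exact: (xgetPex 0 (ex_intro _ c slope_c)).
Qed.

(** * The threshold [beta_star] and the maximizer [m_star] *)

Lemma beta_star_lt (beta0 : R) p : (0 < p)%N -> beta_star p < beta0 < ln 2 ->
  0 <= beta0 /\ exists2 x, -1 <= x <= 1 & 0 < H beta0 p x.
Proof.
move=> p0 /andP[b1 b2].
set S := [set b : R | 0 <= b /\ sup [set H b p x | x in `[-1, 1]] = 0]%classic.
have H_sup b : 0 <= b -> (forall x, -1 <= x <= 1 -> H b p x <= 0) -> S b.
  move=> b0 Hb; split=> //; apply/eqP; rewrite eq_le; apply/andP; split.
    apply: ge_sup.
      by exists (H b p 0), 0 => //=; rewrite in_itv/=; apply/andP; split; lra.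
    by move=> _ [x /= x11 <-]; apply: Hb; rewrite in_itv in x11.
  apply: ub_le_sup.
    by exists 0 => _ [x /= x11 <-]; apply: Hb; rewrite in_itv in x11.
  exists 0; last exact: H_at0.
  by rewrite /= in_itv/=; apply/andP; split; lra.
have S0 : S 0.
  by apply: H_sup => // x x11; rewrite H_rate mul0r sub0r oppr_le0 rate_ge0.
(* [H b p 1 = b - ln 2] cannot exceed the supremum 0. Boundedness makes [beta_star] a genuine upper
   bound of [S]. *)
have S_bound b : S b -> b <= ln 2.
  move=> [b0 supb]; rewrite -subr_le0 -(H_at1 b p) -supb; apply: ub_le_sup.
    have [c [c11 cmax]] := global_max_exists b p.
    by exists (H b p c) => _ [x /= x11 <-]; apply: cmax; rewrite in_itv in x11.
  by exists 1 => //=; rewrite in_itv/=; apply/andP; split; lra.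
have ubS : has_ubound S by exists (ln 2).
have b0 : 0 <= beta0 by apply: le_trans (ltW b1); exact: ub_le_sup.
split=> //; have [//|no] := pselect (exists2 x, -1 <= x <= 1 & 0 < H beta0 p x).
have : beta0 <= beta_star p.
  apply: ub_le_sup => //; apply: H_sup => // x x11.
  by rewrite leNgt; apply/negP => Hx; apply: no; exists x.
by rewrite leNgt b1.
Qed.

Lemma m_star_global_max (beta0 : R) p : (0 < p)%N -> beta_star p < beta0 < ln 2 ->
  global_max beta0 p (m_star beta0 p) /\ 0 < H beta0 p (m_star beta0 p).
Proof.
move=> p0 hb; have [b0 [x x11 Hx]] := beta_star_lt beta0 p p0 hb.
have /andP[_ b2] := hb.
have [c [c11 cmax]] := global_max_exists beta0 p.
(* The absolute value of a maximizer is again one. As [H] is positive there, it differs from 0 and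
   1, so [xget] has a candidate. *)
have Hc : 0 < H beta0 p `|c|.
  by apply: lt_le_trans (H_le_norm _ _ _ b0); exact: lt_le_trans Hx (cmax _ x11).
have c_le1 : `|c| <= 1 by rewrite ler_norml.
have c_neq1 : `|c| != 1.
  by apply: contraTneq Hc => ->; rewrite H_at1 -leNgt subr_le0 ltW.
have c_neq0 : `|c| != 0 by apply: contraTneq Hc => ->; rewrite H_at0// ltxx.
have : positive_maximizer beta0 p (m_star beta0 p).
  apply: (xgetPex 0 (ex_intro _ `|c| _)); split.
    by rewrite lt_def c_neq0 normr_ge0/= lt_neqAle c_neq1.
  move=> y; rewrite in_itv/= => y11.
  exact: le_trans (cmax _ y11) (H_le_norm _ _ _ b0).
move=> [/andP[m0 m1] mmax]; split.
  split; first by apply/andP; split; lra.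
  by move=> y y11; apply: mmax; rewrite in_itv.
by apply: lt_le_trans Hx _; apply: mmax; rewrite in_itv.
Qed.

End Slope.

Theorem theorem5 (R : realType) (p : nat) (beta0 : R) (hp : (3 <= p)%N)
    (hbeta0 : beta_star p < beta0 < ln 2) :
  exists2 betal : R, 0 < betal &
    forall delta : R, 0 < delta < 1 ->
    forall beta : R, betal < beta ->
      N_star beta0 beta delta p = - (ln delta / H beta0 p (m_star beta0 p))
      /\ 0 < - (ln delta / H beta0 p (m_star beta0 p)).
Proof.
have p0 : (0 < p)%N by rewrite (leq_trans _ hp).
have [mmax Hm] := m_star_global_max beta0 p p0 hbeta0.
have [b0 _] := beta_star_lt beta0 p p0 hbeta0.
have /andP[_ b2] := hbeta0.
have [|M MP] := mple_bounded beta0 p hp; first by rewrite b0.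
have ln2 : 0 < ln 2 :> R by rewrite ln_gt0// ltr1n.
(* Above [ln 2] the estimator is consistent; above [M] its limit exceeds every value taken where
   [H beta0 p] is positive. *)
exists (Num.max (ln 2) M) => [|delta delta01 beta].
  by rewrite lt_max ln2.
rewrite gt_max => /andP[lb Mb].
have /bahadur_slopeE slopeE := is_bahadur_slope_max beta0 beta p M _ hp MP mmax lb Mb.
split; last by rewrite -mulNr divr_gt0// oppr_gt0 ln_lt0.
by rewrite /N_star slopeE; field; exact: lt0r_neq0.
Qed.
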